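(* For all integers $n\ge2$, $C(n,0)=C(n,180^\circ)=n-1$.
   Context: A set $A\subset\mathbb{R}^n$ contains the angle $\alpha\in[0,180^\circ]$ if there exist distinct points $x,y,z\in A$ such that the angle between the vectors $y-x$ and $z-x$ is $\alpha$. Let $\dim$ denote Hausdorff dimension. For an integer $n\ge2$ and $\alpha\in[0,180^\circ]$ define $$C(n,\alpha)=\sup\{s : \text{there is a compact } A\subset\mathbb{R}^n \text{ with } \dim(A)=s \text{ such that } A \text{ does not contain the angle } \alpha\}.$$ *)

(* Defs.v *)
From HB Require Import structures.
From mathcomp Require Import all_boot all_order all_algebra.
From mathcomp Require Import all_classical all_reals all_analysis.

Set Implicit Arguments.
Unset Strict Implicit.
Unset Printing Implicit Defensive.

Import Order.TTheory GRing.Theory Num.Theory.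
Import numFieldNormedType.Exports.

Local Open Scope classical_set_scope.
Local Open Scope ring_scope.

Section EuclideanSpace.
Context {R : realType} {n : nat}.
Implicit Types u v x y : 'rV[R]_n.

Definition dotp u v : R := \sum_(i < n) u 0 i * v 0 i.

(* The library's norm `|u| on 'rV[R]_n is the sup norm: it induces the same
   topology, but is not the norm that angles and diameters refer to. *)
Definition enorm u : R := Num.sqrt (dotp u u).

(* In radians, with values in [0, pi]; meaningful for nonzero vectors. *)
Definition angle u v : R := acos (dotp u v / (enorm u * enorm v)).

Definition contains_angle (A : set 'rV[R]_n) (alpha : R) : Prop :=
  exists x y z, [/\ A x, A y & A z] /\ [/\ x <> y, x <> z & y <> z] /\
    angle (y - x) (z - x) = alpha.

Local Open Scope ereal_scope.

(* The added 0 only matters for the empty set, which gets diameter 0. *)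
Definition diam (U : set 'rV[R]_n) : \bar R :=
  ereal_sup (0 |` [set e | exists x y, [/\ U x, U y & e = (enorm (x - y))%:E]]).

(* diam(U)^s, with 0^0 = 1 for singletons but the value 0 on the empty set for
   every s, so that the 0-dimensional measure is the counting measure. *)
Definition diam_pow (s : R) (U : set 'rV[R]_n) : \bar R :=
  if U == set0 then 0 else poweR (diam U) s.

Definition hausdorff_premeasure (s delta : R) (A : set 'rV[R]_n) : \bar R :=
  ereal_inf [set e | exists U : nat -> set 'rV[R]_n,
    [/\ A `<=` \bigcup_i U i,
        forall i, diam (U i) <= delta%:E &
        e = \sum_(0 <= i <oo) diam_pow s (U i)]].

(* The limit as delta -> 0+ is a supremum, since hausdorff_premeasure is
   nonincreasing in delta. *)
Definition hausdorff_measure (s : R) (A : set 'rV[R]_n) : \bar R :=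
  ereal_sup [set hausdorff_premeasure s delta A |
             delta in [set delta : R | (0 < delta)%R]].

Definition hausdorff_dim (A : set 'rV[R]_n) : \bar R :=
  ereal_inf [set s%:E | s in [set s : R | (0 <= s)%R /\
                              hausdorff_measure s A = 0]].

End EuclideanSpace.

(* C(n, alpha), with alpha in radians. *)
Definition angle_threshold (R : realType) (n : nat) (alpha : R) : \bar R :=
  ereal_sup [set s : \bar R | exists A : set 'rV[R]_n,
    [/\ compact A, hausdorff_dim A = s & ~ contains_angle A alpha]].

(* Main.v *)
Require Import Defs.
From mathcomp Require Import all_boot all_order all_algebra.
From mathcomp Require Import all_classical all_reals all_analysis.
From mathcomp Require Import finmap ring lra zify.

(* Three distinct collinear points contain both the angle 0 (at an extreme point)
   and the angle pi (at the middle one), so both thresholds concern compact sets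
   without three collinear points.

   Lower bound: the paraboloid x_0 = |x'|^2 over the cube [0,1]^(n-1) has no three
   collinear points by strict convexity, and counting the points of a fine grid
   that a cover can capture shows that its (n-1)-dimensional measure is positive.

   Upper bound: let A be compact without three collinear points and s > n-1. Fix
   a scale 2^-j and a much smaller scale 2^-k. Frostman weights w on the dyadic
   cubes of scales 2^-j to 2^-k have a total mass W that dominates the s-cost of a
   dyadic cover of A, so it suffices that W is small. By compactness, for k large
   every tube of width 2^-k meets boundedly many 2^-j-cubes of A, so for every
   direction Cauchy-Schwarz bounds W^2 by (number of tubes) times the w-mass of
   the pairs of points in a common tube and a common 2^-j-cube. Two points at
   distance r share a tube for a proportion r^-(n-1) 2^-k(n-1) of the directions,
   so averaging over the directions leaves the (n-1)-energy of w on 2^-j-cubes,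
   which is at most a constant times W 2^(-j(s-n+1)). *)

Set Implicit Arguments.
Unset Strict Implicit.
Unset Printing Implicit Defensive.

Import Order.TTheory GRing.Theory Num.Theory.
Import numFieldNormedType.Exports.

Local Open Scope classical_set_scope.
Local Open Scope ring_scope.

(** * Cauchy-Schwarz over fibres *)

Lemma sqr_sum_le_card (R : realFieldType) (F : finType) (M : F -> R) :
  (\sum_f M f) ^+ 2 <= #|F|%:R * \sum_f M f ^+ 2.
Proof.
have [F0|Fpos] := posnP #|F|.
  have E (f : F) : False by have := fintype0 f.
  rewrite [\sum_f M f]big1 ?expr0n ?F0 ?mul0r //= => f; case: (E f).
set W := \sum_f M f; set c : R := #|F|%:R.
have c0 : 0 < c by rewrite ltr0n.
have : 0 <= \sum_f (W - c * M f) ^+ 2 by apply: sumr_ge0 => f _; exact: sqr_ge0.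
under eq_bigr => f _ do
  have -> : (W - c * M f) ^+ 2 = W ^+ 2 + (- 2 * W * c) * M f + c ^+ 2 * M f ^+ 2
    by ring.
rewrite 2!big_split /= sumr_const -!mulr_sumr -/W -mulr_natl -/c => h.
rewrite -(ler_pM2l c0) -subr_ge0; apply: le_trans h _; lra.
Qed.

(** The hypothesis says that [g] takes at most two values on [P]. If [a] and [b] are the weights of
    the two classes, the claim is [(a + b)^2 <= 2 (a^2 + b^2)]. *)
Lemma sqr_sum_le_two_classes (R : realFieldType) (I : finType) (K : eqType)
    (g : I -> K) (P : pred I) (w : I -> R) :
  (forall x y z, P x -> P y -> P z ->
     [|| g x == g y, g x == g z | g y == g z]) ->
  (\sum_(x | P x) w x) ^+ 2 <=
    2 * \sum_(x | P x) \sum_(y | P y && (g x == g y)) w x * w y.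
Proof.
move=> h3; have [x0 Px0|P0] := pickP P; last first.
  by rewrite !big_pred0 // expr0n mulr0.
rewrite (bigID (fun x => g x == g x0)) /=.
rewrite [X in _ <= 2 * X](bigID (fun x => g x == g x0)) /=.
set a := \sum_(i | P i && (g i == g x0)) w i.
set b := \sum_(i | P i && (g i != g x0)) w i.
have -> : \sum_(i | P i && (g i == g x0))
    \sum_(y | P y && (g i == g y)) w i * w y = a * a.
  rewrite mulr_suml; apply: eq_bigr => x /andP[_ /eqP gx].
  by rewrite mulr_sumr gx; apply: eq_bigl => y; rewrite eq_sym.
have -> : \sum_(i | P i && (g i != g x0))
    \sum_(y | P y && (g i == g y)) w i * w y = b * b.
  rewrite mulr_suml; apply: eq_bigr => x /andP[Px gx].
  rewrite mulr_sumr; apply: eq_bigl => y; case Py: (P y) => //=.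
  have := h3 _ _ _ Px0 Px Py.
  rewrite eq_sym (negbTE gx) /= [g x0 == g y]eq_sym.
  case: (altP (g y =P g x0)) => [-> _|_ /= ->] //.
  by rewrite (negbTE gx).
rewrite -subr_ge0; have -> : 2 * (a * a + b * b) - (a + b) ^+ 2 = (a - b) ^+ 2.
  by ring.
exact: sqr_ge0.
Qed.

(** Cauchy-Schwarz over the fibres of [f], then the two-class bound inside each fibre. In the
    application a fibre is a tube and [g] gives the cube of scale 2^-j. *)
Lemma sqr_sum_le_fibers (R : realFieldType) (I F : finType) (K : eqType)
    (f : I -> F) (g : I -> K) (w : I -> R) :
  (forall x y z, f x = f y -> f x = f z ->
     [|| g x == g y, g x == g z | g y == g z]) ->
  (\sum_x w x) ^+ 2 <= 2 * #|F|%:R *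
    \sum_x \sum_(y | (f x == f y) && (g x == g y)) w x * w y.
Proof.
move=> h3; rewrite (partition_big f predT) //=.
apply: le_trans (sqr_sum_le_card _) _.
rewrite [2 * _]mulrC -mulrA ler_wpM2l ?ler0n //.
rewrite [X in _ <= 2 * X](partition_big f predT) //= mulr_sumr.
apply: ler_sum => phi _.
apply: le_trans (sqr_sum_le_two_classes (g := g) _ _) _.
  by move=> x y z /eqP fx /eqP fy /eqP fz; apply: h3; rewrite fx ?fy ?fz.
rewrite ler_wpM2l //; apply: ler_sum => x /eqP fx.
by rewrite fx; under [leRHS]eq_bigl do rewrite (eq_sym phi).
Qed.

(** * Frostman weights on a finite nested system of cells *)

Section Frostman.
Variables (R : realFieldType) (I : finType) (K : eqType) (d : nat).
Variables (cell : 'I_d.+1 -> I -> K) (cap : 'I_d.+1 -> R).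

Let mass (w : I -> R) t x := \sum_(y | cell t y == cell t x) w y.

(* Serve the leaves one after the other, each receiving as much weight as the
   capacities of its cells still allow. *)
Lemma greedy_weights : (forall t, 0 <= cap t) ->
  exists w : I -> R, [/\ forall x, 0 <= w x,
    forall t x, mass w t x <= cap t & forall x, exists t, mass w t x = cap t].
Proof.
move=> cap0.
suff [w [w0 wc wt]] : exists w : I -> R, [/\ forall x, 0 <= w x,
    forall t x, mass w t x <= cap t &
    forall x, x \in enum I -> exists t, mass w t x = cap t].
  by exists w; split => // x; apply: wt; rewrite mem_enum.
elim: (enum I) => [|x0 s [w [w0 wc wt]]].
  exists (fun=> 0); split => // t x; rewrite /mass big1 //.
pose slack t := cap t - mass w t x0.
have [i _ imin] := @arg_minP _ _ _ ord0 predT slack isT.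
have e0 : 0 <= slack i by rewrite subr_ge0 wc.
pose w' x := w x + (x == x0)%:R * slack i.
have mE t x : mass w' t x = mass w t x + (cell t x0 == cell t x)%:R * slack i.
  rewrite /mass /w' big_split /=; congr +%R.
  rewrite -mulr_suml; congr *%R; case: (boolP (_ == _)) => cx.
    rewrite (bigD1 x0) //= eqxx big1 ?addr0 // => y /andP[_ /negbTE ->] //.
  rewrite big1 // => y cy; case: eqP => // yx; move: cx; rewrite -yx.
  by rewrite cy.
have w'c t x : mass w' t x <= cap t.
  rewrite mE; case: (boolP (_ == _)) => [/eqP cx|_]; last by rewrite mul0r addr0.
  have -> : mass w t x = mass w t x0 by rewrite /mass cx.
  have := imin t isT; rewrite /= /slack => h; rewrite /slack mul1r; lra.
exists w'; split => // [x|x].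
  by rewrite addr_ge0 // mulr_ge0.
rewrite inE => /predU1P[->|xs].
  by exists i; rewrite mE eqxx /slack mul1r addrC subrK.
have [t tx] := wt _ xs; exists t; apply: le_anti; rewrite w'c mE -tx lerDl.
by rewrite mulr_ge0.
Qed.

(** Every leaf lies in a saturated cell of the greedy weights; [tau] picks the coarsest one. By
    nesting, the cells so chosen are equal or disjoint, and each carries a mass equal to its
    capacity, so the capacities add up to at most the total weight. [S] holds one leaf per chosen
    cell. *)
Lemma frostman_weights : (forall t, 0 <= cap t) ->
  (forall (t t' : 'I_d.+1) x y, (t <= t')%N ->
     cell t' x = cell t' y -> cell t x = cell t y) ->
  exists (w : I -> R) (S : {set I}) (tau : I -> 'I_d.+1),
  [/\ forall x, 0 <= w x,
      forall t x, \sum_(y | cell t y == cell t x) w y <= cap t,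
      \sum_(x in S) cap (tau x) <= \sum_x w x &
      forall x, exists2 y, y \in S & cell (tau y) x = cell (tau y) y].
Proof.
move=> cap0 nested; have [w [w0 wc wt]] := greedy_weights cap0.
have /boolp.choice [tau tauP] : forall x, exists t, mass w t x = cap t /\
    forall t', mass w t' x = cap t' -> (t <= t')%N.
  move=> x; have [i0 /eqP i0P] := wt x.
  have [i /eqP iP imin] :=
    @arg_minnP _ i0 (fun t => mass w t x == cap t) val i0P.
  by exists i; split => // t' /eqP; exact: imin.
pose key x := (tau x, cell (tau x) x).
pose rep x := odflt x [pick y | key y == key x].
have keyrep x : key (rep x) = key x.
  by rewrite /rep; case: pickP => [y /eqP //|/(_ x)]; rewrite eqxx.
have repE x y : key x = key y -> rep x = rep y.
  move=> kxy; rewrite /rep kxy; case: pickP => [//|/(_ y)]; rewrite eqxx //.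
pose S := [set x | rep x == x]%SET; exists w, S, tau; split => //; last first.
  move=> x; exists (rep x); first by rewrite inE (repE _ x).
  by have [-> <-] := keyrep x.
under eq_bigr => x _ do rewrite -(tauP x).1 /mass big_mkcond.
rewrite exchange_big /=; apply: ler_sum => y _; rewrite -big_mkcondr /=.
have [x0 /andP[]|none] :=
  pickP (fun x => (x \in S) && (cell (tau x) y == cell (tau x) x));
  last by rewrite big_pred0.
rewrite inE => /eqP rx0 /eqP cx0.
suff uni x : (x \in S) && (cell (tau x) y == cell (tau x) x) ->
    x = x0.
  rewrite (big_pred1 x0) // => x /=; apply/idP/eqP => [/uni //|->].
  by rewrite inE rx0 eqxx cx0 eqxx.
rewrite inE => /andP[/eqP rx /eqP cx].
(* If two chosen cells share [y], the coarser contains the finer; it is then a saturated cell of [v]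
   too, and minimality of [tau v] forces equal levels. *)
have taule u v : cell (tau u) y = cell (tau u) u ->
    cell (tau v) y = cell (tau v) v -> (tau u <= tau v)%N ->
    tau u = tau v /\ cell (tau u) u = cell (tau u) v.
  move=> cu cv uv; have cuv : cell (tau u) v = cell (tau u) u.
    by rewrite -(nested _ _ _ _ uv cv).
  split; last by rewrite cuv.
  apply/val_inj/eqP; rewrite eqn_leq uv /=; apply: (tauP v).2.
  by rewrite /mass cuv; exact: (tauP u).1.
rewrite -rx -rx0; apply: repE; rewrite /key.
have [le|/ltnW le] := leqP (tau x) (tau x0).
  by have [e1 e2] := taule _ _ cx cx0 le; rewrite -e1 e2.
by have [e1 e2] := taule _ _ cx0 cx le; rewrite -e1 e2.
Qed.

End Frostman.

(** * Geometric sums and counting of integers *)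

Lemma geometric_sum_le (R : realFieldType) (q : R) (j d : nat) :
  0 <= q < 1 -> \sum_(t < d) q ^+ (j + t) <= q ^+ j / (1 - q).
Proof.
move=> /andP[q0 q1]; rewrite ler_pdivlMr ?subr_gt0 //.
under eq_bigr do rewrite exprD.
rewrite -mulr_sumr -mulrA ler_piMr ?exprn_ge0 //.
rewrite mulrC -opprB mulNr -subrX1 opprB lerBlDr lerDl exprn_ge0 //.
Qed.

Lemma card_ord_window N (S : {set 'I_N}) (a q : nat) :
  (forall v, v \in S -> (a <= v <= a + q)%N) -> (#|S| <= q.+1)%N.
Proof.
move=> aS; pose h (v : 'I_N) : 'I_q.+1 := inord (v - a).
rewrite -[X in (_ <= X)%N]card_ord; apply: (@leq_card_in _ _ h) => u v /aS uS /aS vS.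
move=> /(congr1 val); rewrite /= !inordK; first by move=> ?; apply/val_inj => /=; lia.
  by lia.
by lia.
Qed.

(** Two admissible integers differ by at most [2 / |b|]. The form multiplied by [|b|] remains valid
    for [b = 0]. *)
Lemma card_near_multiples (R : realType) N (al b : R) :
  #|[set v : 'I_N | `|al - v%:R * b| < 1]%SET|%:R * `|b| <= 2 + `|b|.
Proof.
set S := [set v | _]%SET.
have [->|b0] := eqVneq b 0; first by rewrite normr0 mulr0 addr0.
have bpos : 0 < `|b| by rewrite normr_gt0.
have [v0 v0S|S0] := pickP (mem S); last first.
  by rewrite (eq_card0 S0) mul0r addr_ge0.
have [u uS umin] := @arg_minnP _ v0 (mem S) val v0S.
have lS v : v \in S -> (u <= v <= u + Num.truncn (2 / `|b|))%N.
  move=> vS; have uv := umin v vS; rewrite uv /= -leq_subLR.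
  rewrite truncn_ge_nat ?divr_ge0 // ler_pdivlMr // natrB //.
  move: uS vS; rewrite !inE => uS vS.
  rewrite -[X in X * _]ger0_norm ?subr_ge0 ?ler_nat // -normrM.
  have -> : (v%:R - u%:R) * b = (al - u%:R * b) - (al - v%:R * b) by ring.
  by apply: le_trans (ler_normB _ _) _; lra.
have := card_ord_window lS; rewrite -(ler_nat R) => h.
apply: le_trans (ler_wpM2r (ltW bpos) h) _.
rewrite -addn1 natrD mulrDl mul1r lerD2r -ler_pdivlMr // truncn_le divr_ge0 //.
Qed.

(** * Degenerate angles and collinearity *)

Section Euclidean.
Variables (R : realType) (n : nat).
Implicit Types u v x y z : 'rV[R]_n.

Lemma dotpZl (c : R) u v : dotp (c *: u) v = c * dotp u v.
Proof. by rewrite /dotp mulr_sumr; apply: eq_bigr => i _; rewrite mxE mulrA. Qed.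

Lemma dotpC u v : dotp u v = dotp v u.
Proof. by apply: eq_bigr => i _; rewrite mulrC. Qed.

Lemma dotpZr (c : R) u v : dotp u (c *: v) = c * dotp u v.
Proof. by rewrite dotpC dotpZl dotpC. Qed.

Lemma dotpBl u v w : dotp (u - v) w = dotp u w - dotp v w.
Proof. by rewrite /dotp -sumrB; apply: eq_bigr => i _; rewrite !mxE mulrBl. Qed.

Lemma dotpBr u v w : dotp w (u - v) = dotp w u - dotp w v.
Proof. by rewrite dotpC dotpBl !(dotpC w). Qed.

Lemma dotp_ge0 u : 0 <= dotp u u.
Proof. by apply: sumr_ge0 => i _; rewrite -expr2 sqr_ge0. Qed.

Lemma dotp_eq0 u : dotp u u = 0 -> u = 0.
Proof.
move=> /eqP; rewrite psumr_eq0; last by move=> i _; rewrite -expr2 sqr_ge0.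
move=> /allP u0; apply/rowP => i; rewrite mxE.
by have := u0 i; rewrite mem_index_enum /= mulf_eq0 orbb => /(_ isT)/eqP.
Qed.

Lemma dotp_gt0 u : u != 0 -> 0 < dotp u u.
Proof.
by move=> u0; rewrite lt0r dotp_ge0 andbT; apply: contra_neq u0; exact: dotp_eq0.
Qed.

Lemma sqr_enorm u : enorm u ^+ 2 = dotp u u.
Proof. by rewrite sqr_sqrtr // dotp_ge0. Qed.

Lemma enorm_gt0 u : u != 0 -> 0 < enorm u.
Proof. by move=> u0; rewrite sqrtr_gt0 dotp_gt0. Qed.

Lemma enormZ (c : R) u : enorm (c *: u) = `|c| * enorm u.
Proof.
by rewrite /enorm dotpZl dotpZr mulrA -expr2 sqrtrM ?sqr_ge0 // sqrtr_sqr.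
Qed.

Lemma coord_le_enorm u (i : 'I_n) : `|u 0 i| <= enorm u.
Proof.
rewrite -sqrtr_sqr ler_sqrt ?dotp_ge0 // /dotp (bigD1 i) //= -expr2 lerDl.
by apply: sumr_ge0 => l _; rewrite -expr2 sqr_ge0.
Qed.

Lemma enorm_le_coords u (r : R) : 0 <= r -> (forall i, `|u 0 i| <= r) ->
  enorm u <= Num.sqrt n%:R * r.
Proof.
move=> r0 ur; rewrite -[r in leRHS]ger0_norm // -sqrtr_sqr -sqrtrM ?ler0n //.
rewrite ler_sqrt ?mulr_ge0 ?sqr_ge0 //.
apply: (@le_trans _ _ (\sum_(i < n) r ^+ 2)).
  apply: ler_sum => i _; rewrite -expr2 -real_normK ?num_real //.
  by rewrite lerXn2r ?nnegrE ?normr_ge0.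
by rewrite sumr_const card_ord mulr_natl.
Qed.

Lemma angle_scale u (c d : R) : u != 0 -> c * d != 0 ->
  angle (c *: u) (d *: u) = if 0 < c * d then 0 else pi.
Proof.
move=> u0 cd0; rewrite /angle !enormZ dotpZl dotpZr -sqr_enorm.
have e0 : enorm u != 0 by rewrite gt_eqF ?enorm_gt0.
have -> : c * (d * enorm u ^+ 2) / (`|c| * enorm u * (`|d| * enorm u)) =
    (c * d) / `|c * d|.
  move: cd0; rewrite normrM mulf_eq0 negb_or -(normr_eq0 c) -(normr_eq0 d).
  by move=> /andP[c0 d0]; field; rewrite e0 c0 d0.
case: ltP => [h|]; first by rewrite gtr0_norm // divff // acos1.
rewrite le_eqVlt (negbTE cd0) /= => h.
by rewrite ltr0_norm // invrN mulrN divff // acosN1.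
Qed.

(** The middle point is [x] if [l < 0], [z] if [0 < l < 1], and [y] if [l > 1]. It sees the other
    two under the angle pi, and an extreme point sees them under the angle 0. *)
Lemma collinear_contains_angle (A : set 'rV[R]_n) x y z (l : R) :
  A x -> A y -> A z -> x != y -> l != 0 -> l != 1 -> z - x = l *: (y - x) ->
  contains_angle A 0 /\ contains_angle A pi.
Proof.
move=> Ax Ay Az xy l0 l1 zx; set u := y - x.
have u0 : u != 0 by rewrite subr_eq0 eq_sym.
have yE : y = x + u by rewrite addrC subrK.
have zE : z = x + l *: u by rewrite -zx addrC subrK.
have xz : x <> z.
  by move=> /eqP; rewrite eq_sym -subr_eq0 zx scaler_eq0 (negbTE l0) (negbTE u0).
have yz : y <> z.
  move=> /eqP; rewrite eq_sym zE yE (inj_eq (addrI x)) -subr_eq0 -{2}[u]scale1r.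
  by rewrite -scalerBl scaler_eq0 subr_eq0 (negbTE l1) (negbTE u0).
have xy' : x <> y by apply/eqP.
have ax : angle (y - x) (z - x) = if 0 < l then 0 else pi.
  by rewrite zx -[X in angle X]scale1r angle_scale // mul1r.
have ay : angle (x - y) (z - y) = if 0 < 1 - l then 0 else pi.
  have -> : x - y = (-1) *: u by rewrite scaleN1r opprB.
  have -> : z - y = (l - 1) *: u.
    by rewrite zE yE opprD addrACA subrr add0r scalerBl scale1r.
  by rewrite angle_scale // mulN1r opprB // subr_eq0 eq_sym.
have az : angle (x - z) (y - z) = if 0 < - l * (1 - l) then 0 else pi.
  have -> : x - z = (- l) *: u by rewrite scaleNr -zx opprB.
  have -> : y - z = (1 - l) *: u.
    by rewrite zE yE opprD addrACA subrr add0r scalerBl scale1r.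
  by rewrite angle_scale // mulf_eq0 oppr_eq0 negb_or l0 subr_eq0 eq_sym.
have wx t : angle (y - x) (z - x) = t -> contains_angle A t by exists x, y, z.
have wy t : angle (x - y) (z - y) = t -> contains_angle A t.
  by exists y, x, z; split => //; split => //; split => // /esym.
have wz t : angle (x - z) (y - z) = t -> contains_angle A t.
  by exists z, x, y; split => //; split => //; split => // /esym.
have [lneg|lpos|lz] := ltgtP l 0; last by rewrite lz eqxx in l0.
  split; last by apply: wx; rewrite ax ltNge (ltW lneg).
  by apply: wy; rewrite ay ifT //; lra.
split; first by apply: wx; rewrite ax lpos.
have [ll1|ll1|e] := ltgtP l 1; last by rewrite e eqxx in l1.
  apply: wz; rewrite az ifF //; apply/negbTE; rewrite -leNgt; nra.
by apply: wy; rewrite ay ifF //; apply/negbTE; rewrite -leNgt; lra.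
Qed.

(** The equality case of Cauchy-Schwarz: the squared norm of [w] is [dotp u u] times the
    Cauchy-Schwarz defect, which vanishes because the cosine is 1 or -1. *)
Lemma angle_collinear u v : u != 0 -> v != 0 ->
  angle u v = 0 \/ angle u v = pi -> exists l, v = l *: u.
Proof.
move=> u0 v0 auv.
have uu := dotp_gt0 u0; have vv := dotp_gt0 v0.
set w := dotp u u *: v - dotp u v *: u.
have wE : dotp w w = dotp u u * (dotp u u * dotp v v - dotp u v ^+ 2).
  by rewrite /w !(dotpBl, dotpBr, dotpZl, dotpZr) (dotpC v u); ring.
have eu := enorm_gt0 u0; have ev := enorm_gt0 v0.
pose t := dotp u v / (enorm u * enorm v).
have t2E : t ^+ 2 = dotp u v ^+ 2 / (dotp u u * dotp v v).
  by rewrite /t expr_div_n exprMn !sqr_enorm.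
have t2 : t ^+ 2 <= 1.
  rewrite t2E ler_pdivrMr ?mulr_gt0 // mul1r -subr_ge0.
  by rewrite -(pmulr_rge0 _ uu) -wE dotp_ge0.
have tI : t \in `[(-1), 1] by rewrite in_itv /=; apply/andP; split; nra.
have t1 : t ^+ 2 = 1.
  rewrite -(acosK tI) -/(angle u v).
  by case: auv => ->; rewrite ?cos0 ?cospi ?expr1n ?sqrrN ?expr1n.
have w0 : w = 0.
  apply: dotp_eq0; rewrite wE; apply/eqP; rewrite mulf_eq0 subr_eq0; apply/orP; right.
  by move: t1; rewrite t2E => /divr1_eq ->.
exists (dotp u v / dotp u u); apply: (scalerI (a := dotp u u)).
  by rewrite gt_eqF.
move: w0 => /eqP; rewrite subr_eq0 => /eqP ->.
by rewrite scalerA mulrCA divff ?mulr1 // gt_eqF.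
Qed.

End Euclidean.

(** * Diameters and Hausdorff premeasures *)

Section Hausdorff.
Variables (R : realType) (n : nat).
Implicit Types (A U : set 'rV[R]_n) (s delta r : R).
Local Open Scope ereal_scope.

Lemma diam_ge0 U : 0 <= diam U.
Proof. by apply: ereal_sup_ubound; left. Qed.

Lemma enorm_le_diam U x y : U x -> U y -> (enorm (x - y))%:E <= diam U.
Proof. by move=> Ux Uy; apply: ereal_sup_ubound; right; exists x, y. Qed.

Lemma diam_le U r : (0 <= r)%R ->
  (forall x y, U x -> U y -> (enorm (x - y) <= r)%R) -> diam U <= r%:E.
Proof.
move=> r0 Ur; apply: ge_ereal_sup => _ [-> |[x [y [Ux Uy ->]]]].
  by rewrite lee_fin.
by rewrite lee_fin Ur.
Qed.

Lemma diam_pow_ge0 s U : 0 <= diam_pow s U.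
Proof. by rewrite /diam_pow; case: ifP => // _; exact: poweR_ge0. Qed.

Lemma diam_pow_set0 s : diam_pow s (set0 : set 'rV[R]_n) = 0.
Proof. by rewrite /diam_pow eqxx. Qed.

Lemma diam_pow_le s U r : (0 <= s)%R -> (0 <= r)%R -> diam U <= r%:E ->
  diam_pow s U <= (r `^ s)%:E.
Proof.
move=> s0 r0 Ur; rewrite /diam_pow; case: ifP => _.
  by rewrite lee_fin powR_ge0.
rewrite -poweR_EFin; apply: gt0_ler_poweR => //; rewrite in_itv /= ?leey ?andbT //.
exact: diam_ge0.
Qed.

Lemma hausdorff_premeasure_ge0 s delta A : 0 <= hausdorff_premeasure s delta A.
Proof.
apply: le_ereal_inf_tmp => _ [U [_ _ ->]].
by apply: nneseries_ge0 => i _ _; exact: diam_pow_ge0.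
Qed.

(** The family is enumerated and padded with empty sets, which cost 0 for every exponent, [s = 0]
    included. *)
Lemma hausdorff_premeasure_finite_cover (I : finType) (S : {set I})
    (V : I -> set 'rV[R]_n) (c : I -> R) s delta A : (0 <= delta)%R ->
  (forall x, A x -> exists2 t, t \in S & V t x) ->
  (forall t, t \in S -> diam (V t) <= delta%:E) ->
  (forall t, t \in S -> diam_pow s (V t) <= (c t)%:E) ->
  hausdorff_premeasure s delta A <= (\sum_(t in S) c t)%:E.
Proof.
move=> d0 AV Vd Vc; pose k := size (enum S).
pose U i := nth set0 [seq V t | t <- enum S] i.
have UV i : U i = set0 \/ exists2 t, t \in S & U i = V t.
  have [ik|ik] := ltnP i k; last by left; rewrite /U nth_default // size_map.
  right; have : U i \in [seq V t | t <- enum S] by rewrite mem_nth // size_map.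
  by move=> /mapP[t]; rewrite mem_enum => tS ->; exists t.
apply: (@le_trans _ _ (\sum_(0 <= i <oo) diam_pow s (U i))).
  apply: ereal_inf_lbound; exists U; split => //.
    move=> x /AV[t tS Vx]; exists (index t (enum S)) => //.
    by rewrite /U (nth_map t) ?index_mem ?nth_index ?mem_enum.
  move=> i; have [->|[t tS ->]] := UV i; last exact: Vd.
  by apply: diam_le.
rewrite (nneseries_split 0 k) => [|i _]; last exact: diam_pow_ge0.
rewrite add0n eseries0 ?adde0 => [|i ik _]; last first.
  by rewrite /U nth_default ?diam_pow_set0 ?size_map.
rewrite -sumEFin -[X in _ <= X]big_enum /=.
have -> : (\sum_(0 <= i < k) diam_pow s (U i) =
    \sum_(t <- enum S) diam_pow s (V t))%R.
  by rewrite -(big_map V predT (diam_pow s)) (big_nth set0) size_map.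
rewrite big_enum [X in _ <= X]big_enum /=; exact: lee_sum.
Qed.

End Hausdorff.

(** * Continuity of sums and counting of grid points *)

Lemma continuous_sumr (R : realType) (T : topologicalType) (I : Type)
    (r : seq I) (f : I -> T -> R) :
  (forall i, continuous (f i)) -> continuous (fun x => \sum_(i <- r) f i x).
Proof. by move=> fc x; apply: cvg_big => [|i _]; [exact: add_continuous|exact: fc]. Qed.

Lemma card_ffun_box (R : realType) m N (E : 'I_m -> {set 'I_N}) (c : R) :
  (forall l, #|E l|%:R <= c) ->
  #|[set g : {ffun 'I_m -> 'I_N} | [forall l, g l \in E l]]%SET|%:R <= c ^+ m.
Proof.
move=> Ec; have -> : #|[set g : {ffun 'I_m -> 'I_N} | [forall l, g l \in E l]]%SET| =
    #|family (fun l => mem (E l))|.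
  by apply: eq_card => g; rewrite inE; apply/forallP/familyP.
rewrite card_family foldrE big_map big_enum /= natr_prod.
apply: le_trans (_ : \prod_(l < m) c <= _).
  by apply: ler_prod => l _; rewrite ler0n Ec.
by rewrite prodr_const card_ord.
Qed.

(* Each ball captures at most (3 N r)^m of the N^m grid points. *)
Lemma grid_count (R : realType) m M N (a : 'I_M -> 'I_m -> R) (r : 'I_M -> R) :
  (0 < N)%N -> (forall i, 0 < r i) -> (forall i, 1 <= N%:R * r i) ->
  (forall g : {ffun 'I_m -> 'I_N}, exists i, forall l,
     `|a i l - (g l)%:R / N%:R| < r i) ->
  1 <= 3 ^+ m * \sum_i r i ^+ m.
Proof.
move=> N0 r0 Nr cov.
have NR : 0 < N%:R :> R by rewrite ltr0n.
pose S i := [set g : {ffun 'I_m -> 'I_N} |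
  [forall l, g l \in [set v : 'I_N | `|a i l / r i - v%:R * (N%:R * r i)^-1| < 1]]]%SET.
have cS i : #|S i|%:R <= (3 * (N%:R * r i)) ^+ m.
  apply: card_ffun_box => l.
  have b0 : 0 < N%:R * r i by rewrite mulr_gt0.
  (* This allows at most [2 N r + 1] values per coordinate, hence at most [3 N r] since
     [N r >= 1]. *)
  have := card_near_multiples N (a i l / r i) (N%:R * r i)^-1.
  rewrite gtr0_norm ?invr_gt0 // ler_pdivrMr // mulrDl mulVf ?gt_eqF // => h.
  by apply: le_trans h _; have := Nr i; lra.
have : (#|[set: {ffun 'I_m -> 'I_N}]%SET| <= \sum_i #|S i|)%N.
  apply: leq_trans (_ : #|(\bigcup_i S i)%SET| <= _)%N.
    apply: subset_leq_card; apply/fintype.subsetP => g _; have [i gi] := cov g.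
    apply/finset.bigcupP; exists i => //; rewrite inE; apply/forallP => l; rewrite inE.
    have -> : a i l / r i - (g l)%:R / (N%:R * r i) =
        (a i l - (g l)%:R / N%:R) / r i.
      by field; rewrite !gt_eqF.
    by rewrite normrM normfV (gtr0_norm (r0 i)) ltr_pdivrMr // mul1r gi.
  elim/big_rec2 : _ => [|i k B _ h]; first by rewrite cards0.
  by apply: leq_trans (leq_card_setU _ _) _; rewrite leq_add2l.
rewrite cardsT card_ffun !card_ord -(ler_nat R) natr_sum natrX => h.
rewrite -(ler_pM2l (exprn_gt0 m NR)) mulr1; apply: le_trans h _.
rewrite !mulr_sumr; apply: ler_sum => i _; apply: le_trans (cS i) _.
by rewrite !exprMn mulrCA.
Qed.

(** * Lower bound: the paraboloid *)

Section Paraboloid.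
Variables (R : realType) (m : nat).
Implicit Types x y z : 'rV[R]_m.+1.

Definition paraboloid : set 'rV[R]_m.+1 :=
  [set x | (forall l, 0 <= x 0 (lift ord0 l) <= 1) /\
           x 0 ord0 = \sum_(l < m) x 0 (lift ord0 l) ^+ 2].

Lemma compact_paraboloid : compact paraboloid.
Proof.
pose B (i : 'I_m.+1) : set R := `[0, (if i == ord0 then m%:R else 1)]%classic.
pose h x := x 0 ord0 - \sum_(l < m) x 0 (lift ord0 l) ^+ 2.
have -> : paraboloid =
    [set v : 'rV[R]_m.+1 | forall i, B i (v ord0 i)] `&` h @^-1` [set 0].
  apply/seteqP; split => x /=.
    move=> [x01 x0E]; split; last by rewrite /h x0E subrr.
    move=> i; rewrite /B /= in_itv /=; case: (unliftP ord0 i) => [l ->|->].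
      by rewrite eq_sym (negbTE (neq_lift _ _)); exact: x01.
    rewrite eqxx x0E sumr_ge0 /= => [|l _]; last exact: sqr_ge0.
    apply: le_trans (_ : \sum_(l < m) 1 <= _).
      apply: ler_sum => l _; have /andP[? ?] := x01 l; exact: exprn_ile1.
    by rewrite sumr_const card_ord.
  move=> [xB /eqP]; rewrite /h subr_eq0 => /eqP x0E; split => // l.
  by have := xB (lift ord0 l); rewrite /B /= in_itv /=.
apply: compact_closedI.
  by apply: rV_compact => i; exact: segment_compact.
have hc : continuous h.
  move=> x; apply: (@continuousB _ _ _ (fun x : 'rV[R]_m.+1 => x 0 ord0)).
    exact: coord_continuous.
  apply: continuous_sumr => l y.
  apply: (@continuousM _ _ (fun x : 'rV[R]_m.+1 => x 0 (lift ord0 l))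
    (fun x : 'rV[R]_m.+1 => x 0 (lift ord0 l))); exact: coord_continuous.
by apply: preimage_closed => [x _|]; [exact: hc|exact: closed_eq].
Qed.

(** Inserting [z = x + l (y - x)] into the equation of the paraboloid gives
    [l (l - 1) |y' - x'|^2 = 0], where the prime drops the coordinate 0. Each vanishing factor
    identifies two of the three points. *)
Lemma paraboloid_not_collinear x y z (l : R) :
  paraboloid x -> paraboloid y -> paraboloid z ->
  x <> y -> x <> z -> y <> z -> z - x = l *: (y - x) -> False.
Proof.
move=> [_ x0] [_ y0] [_ z0] xy xz yz zx.
have zE i : z 0 i = x 0 i + l * (y 0 i - x 0 i).
  have /rowP/(_ i) := zx; rewrite !mxE => <-; by rewrite [RHS]addrC subrK.
pose D := \sum_(i < m) (y 0 (lift ord0 i) - x 0 (lift ord0 i)) ^+ 2.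
have : l * (l - 1) * D = 0.
  have := zE ord0; rewrite z0 x0 y0 => h.
  have {h} : \sum_(i < m) z 0 (lift ord0 i) ^+ 2 -
    (\sum_(i < m) x 0 (lift ord0 i) ^+ 2 +
      l * (\sum_(i < m) y 0 (lift ord0 i) ^+ 2 -
        \sum_(i < m) x 0 (lift ord0 i) ^+ 2)) = 0 by rewrite h subrr.
  rewrite -sumrB mulr_sumr -big_split /= -sumrB => <-.
  by rewrite mulr_sumr; apply: eq_bigr => i _; rewrite zE; ring.
move=> /eqP; rewrite !mulf_eq0 -orbA => /or3P[/eqP l0|/eqP l1|/eqP D0].
- by apply: xz; apply/rowP => i; rewrite zE l0 mul0r addr0.
- apply: yz; apply/rowP => i; rewrite zE.
  by move/eqP: l1; rewrite subr_eq0 => /eqP ->; rewrite mul1r addrC subrK.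
have xyl i : y 0 (lift ord0 i) = x 0 (lift ord0 i).
  move/eqP: D0; rewrite psumr_eq0 => [/allP h|j _]; last exact: sqr_ge0.
  have := h i; rewrite mem_index_enum /= => /(_ isT).
  by rewrite sqrf_eq0 subr_eq0 => /eqP.
apply: xy; apply/rowP => i; case: (unliftP ord0 i) => [j ->|->]; first by rewrite xyl.
by rewrite x0 y0; apply: eq_bigr => j _; rewrite xyl.
Qed.

Lemma paraboloid_no_angle (alpha : R) : alpha = 0 \/ alpha = pi ->
  ~ contains_angle paraboloid alpha.
Proof.
move=> al [x [y [z [[Px Py Pz] [[xy xz yz] ayz]]]]].
have nz u v : u <> v -> v - u != 0 :> 'rV[R]_m.+1.
  by move=> uv; rewrite subr_eq0 eq_sym; apply/eqP.
have [|l lE] := @angle_collinear _ _ (y - x) (z - x) (nz _ _ xy) (nz _ _ xz).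
  by rewrite ayz.
exact: (paraboloid_not_collinear Px Py Pz xy xz yz lE).
Qed.

(** Diameters are at most 1 and [s <= m], so it suffices to bound the sum of the [d i ^+ m] from
    below. The sets are enlarged to open balls, compactness leaves finitely many, and [grid_count]
    applies to the grid lifted to the paraboloid. *)
Lemma paraboloid_cover_ge (s : R) (U : nat -> set 'rV[R]_m.+1) :
  (0 < m)%N -> 0 <= s <= m%:R -> paraboloid `<=` \bigcup_i U i ->
  (forall i, diam (U i) <= 1%:E)%E ->
  ((6 ^+ m * 2)^-1%:E <= \sum_(0 <= i <oo) diam_pow s (U i))%E.
Proof.
move=> m0 /andP[s0 sm] PU U1.
pose d i := fine (diam (U i)).
have dE i : diam (U i) = (d i)%:E.
  rewrite fineK // ge0_fin_numE ?diam_ge0 //; exact: le_lt_trans (U1 i) (ltey _).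
have d0 i : 0 <= d i by rewrite -lee_fin -dE diam_ge0.
have d1 i : d i <= 1 by rewrite -lee_fin -dE.
have dpow i : ((d i ^+ m)%:E <= diam_pow s (U i))%E.
  have [dz|dnz] := eqVneq (d i) 0.
    by rewrite dz expr0n gtn_eqF //= diam_pow_ge0.
  rewrite /diam_pow; case: ifP => [/eqP U0|_].
    suff : (diam (U i) <= 0)%E.
      by rewrite dE lee_fin => h; move: dnz; rewrite eq_le h d0.
    by rewrite U0; apply: diam_le.
  rewrite dE poweR_EFin lee_fin -powR_mulrn //; apply: ger_powR => //.
  by rewrite lt0r dnz d0 d1.
have /boolp.choice[a aP] : forall i, exists a, forall x, U i x -> U i a.
  move=> i; have [[a Ua]|nU] := pselect (exists a, U i a); first by exists a.
  by exists 0 => x Ux; case: nU; exists x.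
(* With this choice the enlargements use up only 1/2 of the 1 in [grid_count]; the other half gives
   the constant [(6 ^+ m * 2)^-1]. *)
pose eps : R := (3 ^+ m * 2)^-1.
have eps0 : 0 < eps by rewrite invr_gt0 mulr_gt0 ?exprn_gt0.
have eps1 : eps <= 1.
  rewrite invf_le1 ?mulr_gt0 ?exprn_gt0 //.
  by have : 1 <= (3 : R) ^+ m by [rewrite exprn_ege1 // ler1n]; lra.
pose e i : R := eps * 2^-1 ^+ i.+1.
have e0 i : 0 < e i by rewrite mulr_gt0 // exprn_gt0.
have e1 i : e i <= 1.
  by rewrite mulr_ile1 ?exprn_ge0 ?(ltW eps0) // exprn_ile1 //; lra.
(* The radius must exceed [d i] strictly, also when [d i = 0], while its m-th power stays below
   [2^m d^m] up to a summable error. *)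
pose r i := Num.max (2 * d i) (e i).
have r0 i : 0 < r i by rewrite lt_max e0 orbT.
have rd i : d i < r i.
  rewrite lt_max; have := d0 i; rewrite le_eqVlt => /predU1P[<-|dp].
    by rewrite e0 orbT.
  by apply/orP; left; lra.
have rpow i : r i ^+ m <= 2 ^+ m * d i ^+ m + e i.
  rewrite -exprMn /r; case: (leP (2 * d i) (e i)) => _.
    apply: (@le_trans _ _ (e i)); last by rewrite lerDr exprn_ge0 // mulr_ge0.
    by rewrite -[leRHS]expr1; apply: ler_wiXn2l; rewrite // ltW.
  by rewrite lerDl ltW.
have [D _ DP] : finite_subset_cover setT (fun i => ball (a i) (r i)) paraboloid.
  have := compact_paraboloid; rewrite compact_cover; apply => [i _|x Px].
    exact: ball_open.
  have [i _ Ux] := PU x Px; exists i => //; split => // j k; rewrite ord1.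
  rewrite /ball /=; apply: le_lt_trans (rd i); rewrite -lee_fin -dE.
  apply: le_trans (enorm_le_diam (aP i x Ux) Ux).
  by rewrite lee_fin; have := coord_le_enorm (a i - x) k; rewrite !mxE.
pose M := (\max_(i <- enum_fset D) i).+1.
have DM i : i \in D -> (i < M)%N by move=> iD; rewrite ltnS; apply: leq_bigmax_seq.
(* The sum makes [N] larger than each of the finitely many [1 / r i]. *)
pose N := (\sum_(i < M) (Num.truncn (r i)^-1).+1).+1.
have Nr i : (i < M)%N -> 1 <= N%:R * r i.
  move=> iM; rewrite -ler_pdivrMr // div1r ltW //.
  apply: lt_le_trans (truncnS_gt _) _; rewrite ler_nat /N (bigD1 (Ordinal iM)) //=.
  exact: leqW (leq_addr _ _).
have h : 1 <= 3 ^+ m * \sum_(i < M) r i ^+ m.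
  apply: (@grid_count R m M N (fun i l => a i 0 (lift ord0 l)) (fun i => r i)) => //.
    by move=> i; exact: Nr.
  move=> g; pose p : 'rV[R]_m.+1 := \row_i
    if unlift ord0 i is Some l then (g l)%:R / N%:R
    else \sum_(l < m) ((g l)%:R / N%:R) ^+ 2.
  have pl l : p 0 (lift ord0 l) = (g l)%:R / N%:R by rewrite mxE liftK.
  have Pp : paraboloid p.
    split => [l|]; last by rewrite mxE unlift_none; apply: eq_bigr => l _; rewrite pl.
    rewrite pl divr_ge0 //= ler_pdivrMr ?ltr0n // mul1r ler_nat ltnW //.
  have [i /= iD [_ bi]] := DP p Pp; exists (Ordinal (DM i iD)) => l /=.
  by rewrite -pl; have := bi 0 (lift ord0 l).
apply: le_trans (nneseries_lim_ge M (fun i _ _ => diam_pow_ge0 s (U i))).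
apply: le_trans (_ : (\sum_(i < M) d i ^+ m)%:E <= _)%E; last first.
  by rewrite big_mkord -sumEFin; apply: lee_sum => i _; exact: dpow.
rewrite lee_fin.
have se : \sum_(i < M) e i <= eps.
  rewrite -mulr_sumr; have := @geometric_sum_le R 2^-1 1 M.
  move=> /(_ ltac:(lra)); rewrite expr1 => g1.
  have -> : \sum_(i < M) 2^-1 ^+ i.+1 = \sum_(t < M) 2^-1 ^+ (1 + t) :> R by [].
  by rewrite ler_piMr ?(ltW eps0) //; apply: le_trans g1 _; rewrite ler_pdivrMr; lra.
have hs : \sum_(i < M) r i ^+ m <= 2 ^+ m * \sum_(i < M) d i ^+ m + eps.
  apply: le_trans (_ : \sum_(i < M) (2 ^+ m * d i ^+ m + e i) <= _).
    by apply: ler_sum => i _; exact: rpow.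
  by rewrite big_split /= -mulr_sumr lerD2l.
have h3 : 0 < (3 : R) ^+ m by rewrite exprn_gt0.
have := le_trans h (ler_wpM2l (ltW h3) hs).
rewrite mulrDr /eps [X in _ + X](_ : _ = 2^-1); last by field; rewrite gt_eqF.
rewrite mulrA -exprMn -natrM => h6.
rewrite -div1r ler_pdivrMr ?mulr_gt0 ?exprn_gt0 //; move: h6.
by set T := \sum_(i < M) _; set c := (_ * _)%:R ^+ m; lra.
Qed.

Lemma paraboloid_dim_ge : (0 < m)%N -> (m%:R%:E <= hausdorff_dim paraboloid)%E.
Proof.
move=> m0; apply: le_ereal_inf_tmp => _ [s [s0 Hs] <-]; rewrite lee_fin leNgt.
apply/negP => sm.
suff : ((6 ^+ m * 2)^-1%:E <= hausdorff_measure s paraboloid)%E.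
  by rewrite Hs lee_fin leNgt invr_gt0 mulr_gt0 ?exprn_gt0.
apply: le_trans (_ : hausdorff_premeasure s 1 paraboloid <= _)%E; last first.
  by apply: ereal_sup_ubound; exists 1 => //=; exact: ltr01.
apply: le_ereal_inf_tmp => _ [U [PU U1 ->]].
by apply: paraboloid_cover_ge; rewrite // s0 ltW.
Qed.

End Paraboloid.

(** * Dyadic cubes, tubes and the energy estimate *)

Lemma truncn_divn (R : realType) (q : nat) (t : R) : (0 < q)%N -> 0 <= t ->
  Num.truncn t = (Num.truncn (q%:R * t) %/ q)%N.
Proof.
move=> q0 t0; set a := Num.truncn _.
have /truncn_itv/andP[] : 0 <= q%:R * t by rewrite mulr_ge0.
rewrite -/a => la ua; apply: truncn_def; have qR : 0 < q%:R :> R by rewrite ltr0n.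
rewrite -(ler_pM2l qR) -(ltr_pM2l qR) -!natrM; apply/andP; split.
  by apply: le_trans la; rewrite ler_nat mulnC leq_trunc_div.
by apply: lt_le_trans ua _; rewrite ler_nat mulnC ltn_ceil.
Qed.

Lemma eq_truncn_dist (R : realType) (a b : R) : 0 <= a -> 0 <= b ->
  Num.truncn a = Num.truncn b -> `|a - b| < 1.
Proof.
move=> /truncn_itv/andP[la ua] /truncn_itv/andP[lb ub] ab; rewrite ab in la ua.
by rewrite -natr1 in ua ub; rewrite ltr_norml; apply/andP; split; lra.
Qed.

Section Discretisation.
Variables (R : realType) (m B : nat).
Implicit Types x y z : 'rV[R]_m.+1.

Definition inbox x := forall l, `|x 0 l| <= B%:R.

(* The index of the dyadic cube of side 2^-i containing x; the shift by B makes
   all coordinates nonnegative on the box. *)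
Definition cube i x : {ffun 'I_m.+1 -> nat} :=
  [ffun l => Num.truncn (2 ^+ i * (x 0 l + B%:R))].

(** A colouring of the cubes with [2^(m+1)] colours: distinct cubes of one colour have, in some
    coordinate, indices at least 2 apart, so that their points are more than a side length apart
    there. *)
Definition parity j x : {ffun 'I_m.+1 -> bool} := [ffun l => odd (cube j x l)].

Definition near i x y := forall l, `|x 0 l - y 0 l| <= 2^-1 ^+ i.

(* The cell, in a grid of mesh 1/N, of the projection of x to the hyperplane
   x_0 = 0 along the direction (1, v/N). *)
Definition tube N (v : {ffun 'I_m -> 'I_N}) x : {ffun 'I_m -> 'I_(4 * B * N).+1} :=
  [ffun l => inord (Num.truncn
     (N%:R * (x 0 (lift ord0 l) + 2 * B%:R) - (v l)%:R * x 0 ord0))].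

Lemma inbox_ge0 x l : inbox x -> 0 <= x 0 l + B%:R.
Proof. by move=> /(_ l); rewrite ler_norml => /andP[? _]; rewrite -lerBlDr sub0r. Qed.

Lemma cube_arg_ge0 i x l : inbox x -> 0 <= 2 ^+ i * (x 0 l + B%:R).
Proof. by move=> xB; rewrite mulr_ge0 ?exprn_ge0 ?inbox_ge0. Qed.

Lemma cube_nested i i' x y : inbox x -> inbox y -> (i <= i')%N ->
  cube i' x = cube i' y -> cube i x = cube i y.
Proof.
move=> xB yB ii /ffunP c; apply/ffunP => l; have := c l; rewrite !ffunE.
rewrite -(subnK ii) exprD -!mulrA -natrX => e.
rewrite (truncn_divn (q := 2 ^ (i' - i))) ?expn_gt0 ?cube_arg_ge0 // e.
by rewrite -truncn_divn ?expn_gt0 ?cube_arg_ge0.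
Qed.

Lemma eq_cube_near i x y : inbox x -> inbox y -> cube i x = cube i y -> near i x y.
Proof.
move=> xB yB /ffunP c l; have := c l; rewrite !ffunE.
move=> /(eq_truncn_dist (cube_arg_ge0 _ _ xB) (cube_arg_ge0 _ _ yB)).
rewrite -mulrBr opprD addrACA subrr addr0 normrM ger0_norm ?exprn_ge0 // => h.
by rewrite exprVn -div1r ler_pdivlMr ?exprn_gt0 // mulrC ltW.
Qed.

Lemma near_cube i x y l : inbox x -> inbox y -> `|x 0 l - y 0 l| <= 2^-1 ^+ i ->
  (cube i x l <= (cube i y l).+1)%N.
Proof.
move=> xB yB; rewrite !ffunE truncn_le_nat.
have /truncn_itv/andP[_ h] := cube_arg_ge0 i l yB.
have e0 : 0 < (2 : R) ^+ i by rewrite exprn_gt0.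
rewrite ler_norml => /andP[_].
rewrite exprVn -(ler_pM2l e0) divff ?gt_eqF // => h2.
by rewrite -natr1; move: h h2; lra.
Qed.

Lemma parity_separated j x y : inbox x -> inbox y -> parity j x = parity j y ->
  cube j x != cube j y -> exists l, 2^-1 ^+ j < `|x 0 l - y 0 l|.
Proof.
move=> xB yB /ffunP p c.
have [l /eqP cl|all_eq] := pickP (fun l => cube j x l != cube j y l); last first.
  by case/eqP: c; apply/ffunP => l; apply/eqP; have /negbFE := all_eq l.
exists l; rewrite ltNge; apply/negP => h.
have pl : odd (cube j x l) = odd (cube j y l) by have := p l; rewrite !ffunE.
have := near_cube xB yB h; rewrite distrC in h; have := near_cube yB xB h.
by move: cl pl; set a := cube j x l; set b := cube j y l; lia.
Qed.

Lemma eq_tube N (v : {ffun 'I_m -> 'I_N}) x y : inbox x -> inbox y ->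
  tube v x = tube v y -> forall l,
  `|N%:R * (x 0 (lift ord0 l) - y 0 (lift ord0 l)) -
    (v l)%:R * (x 0 ord0 - y 0 ord0)| < 1.
Proof.
move=> xB yB /ffunP T l; have /(congr1 val) := T l; rewrite !ffunE /=.
(* The shift by [2 * B] in [tube] keeps the truncated quantity between 0 and [4 B N], because the
   slopes [v / N] are at most 1. Hence [inord] loses nothing. *)
have rng u : inbox u ->
    0 <= N%:R * (u 0 (lift ord0 l) + 2 * B%:R) - (v l)%:R * u 0 ord0 <= (4 * B * N)%:R.
  move=> uB; have := uB (lift ord0 l); have := uB ord0; rewrite !ler_norml.
  move=> /andP[a1 a2] /andP[b1 b2]; rewrite !natrM.
  have vN : (v l)%:R <= N%:R :> R by rewrite ler_nat ltnW.
  have v0 : 0 <= (v l)%:R :> R by [].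
  have N0 : 0 <= N%:R :> R by [].
  have B0 : 0 <= B%:R :> R by [].
  have := ler_wpM2l v0 a1; have := ler_wpM2l v0 a2.
  have := ler_wpM2l N0 b1; have := ler_wpM2l N0 b2; have := ler_wpM2r B0 vN.
  by move=> *; apply/andP; split; lra.
have trunc_lt u : inbox u -> (Num.truncn (N%:R * (u 0 (lift ord0 l) + 2 * B%:R) -
    (v l)%:R * u 0 ord0)%R < (4 * B * N).+1)%N.
  by move=> /rng/andP[_ uh]; rewrite ltnS truncn_le_nat -natr1; lra.
rewrite !inordK ?trunc_lt // => /eq_truncn_dist.
have /andP[x0 _] := rng x xB; have /andP[y0 _] := rng y yB => /(_ x0 y0).
by congr (`| _ | < _); ring.
Qed.

(** The slopes are at most 1, so inside a tube the coordinate 0 controls all others up to the mesh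
    [1/N]. *)
Lemma tube_dist N (v : {ffun 'I_m -> 'I_N}) x y l : (0 < N)%N ->
  inbox x -> inbox y -> tube v x = tube v y ->
  `|x 0 l - y 0 l| <= `|x 0 ord0 - y 0 ord0| + N%:R^-1.
Proof.
move=> N0 xB yB T; have NR : 0 < N%:R :> R by rewrite ltr0n.
case: (unliftP ord0 l) => [l' ->|->]; last by rewrite lerDl invr_ge0.
have := eq_tube xB yB T l'; set a := x 0 _ - y 0 _; set b := x 0 _ - y 0 _ => h.
rewrite -(ler_pM2l NR) mulrDr divff ?gt_eqF // -{1}(gtr0_norm NR) -normrM.
have -> : N%:R * a = (v l')%:R * b + (N%:R * a - (v l')%:R * b) by ring.
apply: le_trans (ler_normD _ _) _; rewrite lerD ?(ltW h) // normrM.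
by rewrite ger0_norm // ler_wpM2r // ler_nat ltnW.
Qed.

(** Take for [i] the finest scale up to [k] at which [x] and [y] are near. If [i = k], the number of
    all directions is small enough. Otherwise some coordinate differs by more than [2^-(i+1)]; a
    common tube transfers this to the coordinate 0 up to [1/N], and then each component of [v] is
    confined by [card_near_multiples]. *)
Lemma card_common_tubes j k x y : (j <= k)%N -> inbox x -> inbox y -> near j x y ->
  exists i, [/\ (j <= i <= k)%N, near i x y &
    #|[set v : {ffun 'I_m -> 'I_(2 ^ k)} | tube v x == tube v y]%SET|%:R <=
      (8 * 2 ^+ i) ^+ m :> R].
Proof.
move=> jk xB yB nj; set S := [set v | _]%SET.
have N0 : (0 < 2 ^ k)%N by rewrite expn_gt0.
have NR : 0 < (2 ^ k)%:R :> R by rewrite ltr0n.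
set b := x 0 ord0 - y 0 ord0.
pose E (l : 'I_m) : {set 'I_(2 ^ k)} := [set v : 'I_(2 ^ k) |
  `|(2 ^ k)%:R * (x 0 (lift ord0 l) - y 0 (lift ord0 l)) - v%:R * b| < 1]%SET.
have SE c : (forall l, #|E l|%:R <= c) -> #|S|%:R <= c ^+ m :> R.
  move=> Ec; apply: le_trans (card_ffun_box Ec); rewrite ler_nat.
  apply/subset_leq_card/fintype.subsetP => v; rewrite !inE => /eqP T.
  by apply/forallP => l; rewrite inE; exact: eq_tube.
have EN l : #|E l|%:R <= (2 ^ k)%:R :> R.
  by rewrite ler_nat; apply: leq_trans (max_card _) _; rewrite card_ord.
have [nk|nnk] := pselect (near k x y).
  exists k; rewrite jk leqnn; split => //; apply: SE => l.
  apply: le_trans (EN l) _; rewrite natrX ler_peMl ?exprn_ge0 // ler1n //.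
have [i [/andP[ji ik] ni nni]] :
    exists i, [/\ (j <= i < k)%N, near i x y & ~ near i.+1 x y].
  have [dd kE] : exists dd, k = (j + dd)%N by exists (k - j)%N; rewrite subnKC.
  move: nnk; rewrite kE; elim: dd {kE} => [|dd IH]; first by rewrite addn0.
  rewrite addnS => h; have [n1|n1] := pselect (near (j + dd) x y).
    by exists (j + dd)%N; split => //; rewrite leq_addr ltnSn.
  by have [i [/andP[? ?] ? ?]] := IH n1; exists i; split => //; lia.
exists i; rewrite ji (ltnW ik); split => //.
have [v vS|S0] := pickP (mem S); last first.
  by rewrite (eq_card0 S0) exprn_ge0 // mulr_ge0 ?exprn_ge0.
have [l0 hl0] : exists l, 2^-1 ^+ i.+1 < `|x 0 l - y 0 l|.
  have := nni; rewrite /near -existsNE => -[l /negP]; rewrite -ltNge.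
  by exists l.
have T : tube v x = tube v y by move: vS; rewrite !inE => /eqP.
have := tube_dist l0 N0 xB yB T; rewrite -/b => hb.
apply: SE => l.
have := card_near_multiples (2 ^ k)
  ((2 ^ k)%:R * (x 0 (lift ord0 l) - y 0 (lift ord0 l))) b.
rewrite -/(E l); set c := #|E l|%:R => hc.
have c0 : 0 <= c by [].
have cN : c / (2 ^ k)%:R <= 1 by rewrite ler_pdivrMr // mul1r EN.
have b1 : `|b| <= 1.
  by apply: le_trans (nj ord0) _; rewrite exprn_ile1 //; lra.
(* The count satisfies [c |b| <= 2 + |b| <= 3], and the mesh term adds [c / N <= 1]. *)
have : c * 2^-1 ^+ i.+1 <= 4.
  apply: le_trans (ler_wpM2l c0 (ltW hl0)) _.
  by apply: le_trans (ler_wpM2l c0 hb) _; rewrite mulrDr; lra.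
rewrite exprVn ler_pdivrMr ?exprn_gt0 // exprS => h; apply: le_trans h _; lra.
Qed.

Variables (I : finType) (pt : I -> 'rV[R]_m.+1) (w : I -> R).
Hypotheses (ptB : forall a, inbox (pt a)) (w0 : forall a, 0 <= w a).

Lemma near_mass i (c : R) a : 0 <= c ->
  (forall b, \sum_(b' | cube i (pt b') == cube i (pt b)) w b' <= c) ->
  \sum_(b | `[< near i (pt a) (pt b) >]) w b <= 3 ^+ m.+1 * c.
Proof.
move=> c0 mc.
(* Indices of near points differ by -1, 0 or 1 in each coordinate; adding 1 encodes the offset in
   ['I_3]. Each [e] singles out at most one cube. *)
pose hit (e : {ffun 'I_m.+1 -> 'I_3}) b :=
  [forall l, (cube i (pt b) l).+1 == (cube i (pt a) l + e l)%N].
apply: (@le_trans _ _ (\sum_(e : {ffun 'I_m.+1 -> 'I_3}) \sum_(b | hit e b) w b)).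
  under [leRHS]eq_bigr do rewrite big_mkcond.
  rewrite exchange_big /= big_mkcond; apply: ler_sum => b _.
  have nn (e : {ffun 'I_m.+1 -> 'I_3}) : 0 <= if hit e b then w b else 0.
    by case: ifP.
  case: asboolP => [n|_]; last exact: sumr_ge0.
  pose e : {ffun 'I_m.+1 -> 'I_3} :=
    [ffun l => inord ((cube i (pt b) l).+1 - cube i (pt a) l)].
  have h : hit e b.
    apply/forallP => l; have h1 := near_cube (ptB a) (ptB b) (n l).
    have := n l; rewrite distrC => /(near_cube (ptB b) (ptB a)) h2.
    rewrite [e l]ffunE inordK ?subnKC //; move: h1 h2.
    by set u := cube _ _ _; set v := cube _ _ _; lia.
  by rewrite (bigD1 e) //= h lerDl sumr_ge0.
apply: (@le_trans _ _ (\sum_(e : {ffun 'I_m.+1 -> 'I_3}) c)); last first.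
  by rewrite sumr_const card_ffun !card_ord -[leLHS]mulr_natl natrX.
apply: ler_sum => e _; have [b0 hb0|none] := pickP (hit e); last first.
  by rewrite big_pred0.
apply: le_trans (mc b0); rewrite le_eqVlt; apply/orP; left; apply/eqP.
apply: eq_bigl => b; apply/idP/eqP => [hb|ce]; last by rewrite /hit ce.
apply/ffunP => l; have /forallP/(_ l)/eqP h1 := hb.
by have /forallP/(_ l)/eqP := hb0; rewrite -h1 => -[].
Qed.

Variables (j d : nat) (q : R).
Let k := (j + d)%N.
Hypotheses (q0 : 0 <= q) (B0 : (0 < B)%N).
Hypothesis mass : forall (t : 'I_d.+1) a,
  \sum_(b | cube (j + t) (pt b) == cube (j + t) (pt a)) w b <= q ^+ (j + t).

(** A discrete m-energy of [w] at [pt a]. Each [b] is charged to the scale given by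
    [card_common_tubes]; the points near at scale [j + t] weigh at most [3^(m+1) q^(j+t)], and each
    shares at most [(8 * 2^(j+t))^m] tubes with [pt a]. *)
Lemma energy_le a :
  \sum_(b | cube j (pt a) == cube j (pt b)) w b *
    #|[set v : {ffun 'I_m -> 'I_(2 ^ k)} | tube v (pt a) == tube v (pt b)]%SET|%:R
  <= 8 ^+ m * 3 ^+ m.+1 * \sum_(t < d.+1) (2 ^+ m * q) ^+ (j + t).
Proof.
pose nr (t : 'I_d.+1) b := `[< near (j + t) (pt a) (pt b) >].
apply: (@le_trans _ _ (\sum_b \sum_(t < d.+1 | nr t b)
    w b * (8 * 2 ^+ (j + t)) ^+ m)).
  rewrite [leLHS]big_mkcond; apply: ler_sum => b _.
  have nn (t : 'I_d.+1) : 0 <= w b * (8 * 2 ^+ (j + t)) ^+ m.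
    by rewrite mulr_ge0 ?exprn_ge0 // mulr_ge0 ?exprn_ge0.
  case: eqP => [c|_]; last by apply: sumr_ge0 => t _.
  have [i [/andP[ji ik] ni ci]] :=
    card_common_tubes (leq_addr d j) (ptB a) (ptB b) (eq_cube_near (ptB a) (ptB b) c).
  have it : (i - j < d.+1)%N by rewrite ltnS leq_subLR.
  rewrite (bigD1 (Ordinal it)) /=; last by apply/asboolP; rewrite subnKC.
  rewrite subnKC //; apply: le_trans (ler_wpM2l (w0 b) ci) _.
  by rewrite lerDl sumr_ge0.
under eq_bigr do rewrite big_mkcond.
rewrite exchange_big /= mulr_sumr; apply: ler_sum => t _.
rewrite -big_mkcond /= -mulr_suml.
have := near_mass a (exprn_ge0 (j + t) q0) (mass t).
have e0 : 0 <= (8 * 2 ^+ (j + t)) ^+ m :> R.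
  by rewrite exprn_ge0 // mulr_ge0 ?exprn_ge0.
move=> /(ler_wpM2r e0) /le_trans; apply; rewrite le_eqVlt; apply/orP; left.
by apply/eqP; rewrite !exprMn -!exprM (mulnC m); ring.
Qed.

Hypothesis thin : forall (v : {ffun 'I_m -> 'I_(2 ^ k)}) a b c,
  tube v (pt a) = tube v (pt b) -> tube v (pt a) = tube v (pt c) ->
  parity j (pt a) = parity j (pt b) -> parity j (pt a) = parity j (pt c) ->
  [|| cube j (pt a) == cube j (pt b), cube j (pt a) == cube j (pt c) |
      cube j (pt b) == cube j (pt c)].

(** By [thin], a tube of one parity class meets at most two cubes of scale 2^-j, so
    [sqr_sum_le_fibers] bounds [W^2] for each direction. Summing over the [N^m] directions and
    exchanging the sums brings in the energy. The tubes also number at most a constant times [N^m],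
    so [N] cancels and [W <= C Q] is independent of [k]. *)
Lemma weight_le : 2 ^+ m * q < 1 ->
  \sum_a w a <= 2 * (5 * B%:R) ^+ m * 2 ^+ m.+1 *
    (8 ^+ m * 3 ^+ m.+1 * ((2 ^+ m * q) ^+ j / (1 - 2 ^+ m * q))).
Proof.
move=> th1; set W := \sum_a w a; set Q := _ * (_ / _); set C := _ * 2 ^+ m.+1.
have W0 : 0 <= W by exact: sumr_ge0.
have th0 : 0 <= 2 ^+ m * q by rewrite mulr_ge0 ?exprn_ge0.
have C0 : 0 <= C by rewrite !mulr_ge0 ?exprn_ge0 ?mulr_ge0.
set N := (2 ^ k)%N; have NR : 0 < N%:R :> R by rewrite ltr0n expn_gt0.
pose F : finType := ({ffun 'I_m -> 'I_(4 * B * N).+1} * {ffun 'I_m.+1 -> bool})%type.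
have cF : 2 * #|F|%:R <= C * N%:R ^+ m :> R.
  have -> : #|F| = ((4 * B * N).+1 ^ m * 2 ^ m.+1)%N.
    by rewrite card_prod !card_ffun !card_ord card_bool.
  (* The 5 absorbs the successor: [4 B N + 1 <= 5 B N] as [B] and [N] are positive. *)
  have h : (4 * B * N).+1%:R ^+ m <= (5 * B%:R) ^+ m * N%:R ^+ m :> R.
    rewrite -exprMn lerXn2r ?nnegrE ?mulr_ge0 // -!natrM ler_nat.
    by have : (0 < N)%N; [rewrite expn_gt0|nia].
  have c0 : 0 <= 2 * 2 ^+ m.+1 :> R by rewrite mulr_ge0 ?exprn_ge0.
  rewrite natrM (natrX _ _.+1) (natrX _ 2 m.+1) /C; have := ler_wpM2r c0 h.
  move: (_.+1%:R ^+ m) (2 ^+ m.+1) ((5 * B%:R) ^+ m) (N%:R ^+ m) => u1 u2 u3 u4.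
  by lra.
have step v : W ^+ 2 <= C * N%:R ^+ m * \sum_a \sum_(b |
    (tube (v : {ffun 'I_m -> 'I_N}) (pt a) == tube v (pt b)) &&
    (cube j (pt a) == cube j (pt b))) w a * w b.
  pose f a : F := (tube v (pt a), parity j (pt a)).
  apply: le_trans (sqr_sum_le_fibers (f := f) (g := fun a => cube j (pt a)) _ _) _.
    by move=> a b c [T1 P1] [T2 P2]; exact: (thin T1 T2 P1 P2).
  apply: ler_pM; [by rewrite mulr_ge0| |exact: cF|].
    by apply: sumr_ge0 => a _; apply: sumr_ge0 => b _; rewrite mulr_ge0.
  apply: ler_sum => a _; rewrite le_eqVlt; apply/orP; left; apply/eqP/eq_bigl => b.
  rewrite /f xpair_eqE -andbA; congr (_ && _).
  case: (cube j (pt a) =P cube j (pt b)) => [c|]; rewrite ?andbF //.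
  by rewrite andbT /parity c eqxx.
have : \sum_(v : {ffun 'I_m -> 'I_N}) W ^+ 2 <= C * N%:R ^+ m * (W * Q).
  apply: le_trans (ler_sum _ (fun v _ => step v)) _.
  rewrite -mulr_sumr ler_wpM2l ?mulr_ge0 ?exprn_ge0 //.
  rewrite exchange_big /= mulr_suml; apply: ler_sum => a _.
  apply: (@le_trans _ _ (w a * \sum_(b | cube j (pt a) == cube j (pt b)) w b *
    #|[set v : {ffun 'I_m -> 'I_N} | tube v (pt a) == tube v (pt b)]%SET|%:R)).
    rewrite mulr_sumr (exchange_big_dep (fun b => cube j (pt a) == cube j (pt b))) /=.
      apply: ler_sum => b c; rewrite c; under eq_bigl do rewrite andbT.
      by rewrite sumr_const cardsE mulrA [leRHS]mulr_natr.
    by move=> v b _ /andP[].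
  apply: ler_wpM2l => //; apply: le_trans (energy_le a) _.
  by rewrite ler_wpM2l ?mulr_ge0 ?exprn_ge0 // geometric_sum_le ?th0.
rewrite sumr_const card_ffun !card_ord -[leLHS]mulr_natl (natrX _ N) expr2.
have Nm : 0 < N%:R ^+ m :> R by rewrite exprn_gt0.
have [->|Wn] := eqVneq W 0.
  move=> _; rewrite !mulr_ge0 // ?exprn_ge0 // invr_ge0; lra.
have Wp : 0 < W by rewrite lt0r Wn.
have -> : C * N%:R ^+ m * (W * Q) = N%:R ^+ m * (W * (C * Q)) by ring.
by rewrite ler_pM2l // ler_pM2l.
Qed.

End Discretisation.

(** * Upper bound: compact sets without three collinear points *)

Section NoThreeCollinear.
Variables (R : realType) (m : nat).
Implicit Types (x y z : 'rV[R]_m.+1) (A : set 'rV[R]_m.+1).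

Lemma compact_inbox A : compact A ->
  exists2 B, (0 < B)%N & forall x, A x -> inbox B x.
Proof.
move=> /compact_bounded[M [_ MP]]; exists (Num.truncn M).+2 => // x Ax l.
apply: (@le_trans _ _ `|x|).
  have -> : `|x| = mx_norm x by [].
  by rewrite mx_normrE; exact: (@le_bigmax _ _ _ 0 _ (0, l)).
apply: MP Ax; apply: lt_le_trans (truncnS_gt _) _.
by rewrite ler_nat.
Qed.

(* Three distinct points on a line that is transversal to the hyperplane x_0 = 0. *)
Definition transversal_line x y z :=
  [/\ x 0 ord0 != y 0 ord0, x 0 ord0 != z 0 ord0, y 0 ord0 != z 0 ord0 &
  forall l : 'I_m, (y 0 (lift ord0 l) - x 0 (lift ord0 l)) * (z 0 ord0 - x 0 ord0) =
    (z 0 (lift ord0 l) - x 0 (lift ord0 l)) * (y 0 ord0 - x 0 ord0)].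

Lemma transversal_line_contains_angle A x y z : A x -> A y -> A z ->
  transversal_line x y z -> contains_angle A 0 /\ contains_angle A pi.
Proof.
move=> Ax Ay Az [xy xz yz col].
have b0 : y 0 ord0 - x 0 ord0 != 0 by rewrite subr_eq0 eq_sym.
apply: (@collinear_contains_angle _ _ _ x y z
  ((z 0 ord0 - x 0 ord0) / (y 0 ord0 - x 0 ord0))) => //.
- by apply: contra_neq xy => ->.
- by rewrite mulf_neq0 ?invr_eq0 // subr_eq0 eq_sym.
- apply: contra_neq yz => /divr1_eq e; lra.
apply/rowP => i; rewrite !mxE; case: (unliftP ord0 i) => [l ->|->].
  by apply: (mulIf b0); rewrite -col; field.
by field.
Qed.

(** On the compact set [K] of triples that are pairwise far apart in the coordinate 0, the sum [F]
    of squared minors is continuous and vanishes nowhere, hence has a positive lower bound. Three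
    points in a thin tube make [F] small, so one [d] serves all directions. *)
Lemma thin_tubes A B j : compact A -> (forall x, A x -> inbox B x) ->
  (forall x y z, A x -> A y -> A z -> ~ transversal_line x y z) ->
  exists d, forall (v : {ffun 'I_m -> 'I_(2 ^ (j + d))}) x y z,
    A x -> A y -> A z -> tube B v x = tube B v y -> tube B v x = tube B v z ->
    parity B j x = parity B j y -> parity B j x = parity B j z ->
    [|| cube B j x == cube B j y, cube B j x == cube B j z |
        cube B j y == cube B j z].
Proof.
move=> cA AB noline.
pose V := 'rV[R]_m.+1; pose V3 := (V * (V * V))%type.
pose cx (i : 'I_m.+1) (p : V3) : R := p.1 0 i.
pose cy (i : 'I_m.+1) (p : V3) : R := p.2.1 0 i.
pose cz (i : 'I_m.+1) (p : V3) : R := p.2.2 0 i.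
have cxC i : continuous (cx i).
  move=> p; apply: (@continuous_comp _ _ _ fst (fun x : V => x 0 i)).
    exact: cvg_fst.
  exact: coord_continuous.
have cyC i : continuous (cy i).
  move=> p; apply: (@continuous_comp _ _ _ (fst \o snd) (fun x : V => x 0 i)).
    by apply: continuous_comp; [exact: cvg_snd|exact: cvg_fst].
  exact: coord_continuous.
have czC i : continuous (cz i).
  move=> p; apply: (@continuous_comp _ _ _ (snd \o snd) (fun x : V => x 0 i)).
    by apply: continuous_comp; [exact: cvg_snd|exact: cvg_snd].
  exact: coord_continuous.
have subC (f g : V3 -> R) : continuous f -> continuous g ->
    continuous (fun p => f p - g p).
  by move=> fc gc p; apply: (@continuousB _ _ _ f g); [exact: fc|exact: gc].
have mulC (f g : V3 -> R) : continuous f -> continuous g ->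
    continuous (fun p => f p * g p).
  by move=> fc gc p; apply: (@continuousM _ _ f g); [exact: fc|exact: gc].
pose minor l p := (cy (lift ord0 l) p - cx (lift ord0 l) p) * (cz ord0 p - cx ord0 p) -
  (cz (lift ord0 l) p - cx (lift ord0 l) p) * (cy ord0 p - cx ord0 p).
pose F p := \sum_(l < m) minor l p * minor l p.
have FC : continuous F.
  have mC l : continuous (minor l) by apply: (subC); apply: (mulC); exact: subC.
  by apply: continuous_sumr => l; exact: mulC.
(* Half of 2^-j: points of distinct cubes of one parity are more than 2^-j apart in some coordinate,
   and passing to the coordinate 0 costs at most [1/N <= del]. *)
pose del : R := 2^-1 ^+ j.+1.
have del0 : 0 < del by rewrite exprn_gt0.
pose far (f g : V3 -> R) : set V3 := [set p | del <= `|f p - g p|].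
have farC f g : continuous f -> continuous g -> closed (far f g).
  move=> fc gc; apply: (@preimage_closed _ _ (fun p => `|f p - g p|)
    [set t | del <= t]); last exact: closed_ge.
  move=> p _; apply: (@continuous_comp _ _ _ (fun p => f p - g p)).
    exact: subC.
  exact: norm_continuous.
pose K := (A `*` (A `*` A)) `&` (far (cx ord0) (cy ord0) `&`
  (far (cx ord0) (cz ord0) `&` far (cy ord0) (cz ord0))).
have cK : compact K.
  apply: compact_closedI; first by do 2! apply: compact_setX => //.
  by apply: closedI; [exact: farC|apply: closedI; exact: farC].
have farN f g p : far f g p -> f p != g p.
  by move=> h; rewrite -subr_eq0 -normr_gt0; apply: lt_le_trans h.
have [eps eps0 epsK] : exists2 eps, 0 < eps & forall p, K p -> eps <= F p.
  have [K0|K0] := pselect (K !=set0); last first.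
    by exists 1 => // p Kp; case: K0; exists p.
  have [p pK pmin] := compact_EVT_min K0 cK (continuous_subspaceT FC).
  exists (F p); last by move=> t Kt; apply: pmin; exact: mem_set.
  move: pK => /set_mem[[A1 [A2 A3]] [f1 [f2 f3]]].
  have sq0 l : 0 <= minor l p * minor l p by rewrite -expr2 sqr_ge0.
  rewrite lt0r sumr_ge0 // andbT psumr_eq0 //; apply/negP => /allP h.
  apply: (noline _ _ _ A1 A2 A3).
  split; [exact: farN f1|exact: farN f2|exact: farN f3|] => l.
  have := h l; rewrite mem_index_enum /= mulf_eq0 orbb subr_eq0 => /(_ isT)/eqP.
  exact.
(* Large enough that [16 m B^2 / N < eps]; being positive, [d] also ensures [1/N <= del]. *)
pose d := (Num.truncn (16 * m%:R * B%:R ^+ 2 / eps)).+2; exists d => v x y z Ax Ay Az.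
move=> Txy Txz Pxy Pxz; set N := (2 ^ (j + d))%N.
have N0 : (0 < N)%N by rewrite expn_gt0.
have NR : 0 < N%:R :> R by rewrite ltr0n.
have Nd : N%:R^-1 <= del.
  rewrite /N natrX -exprVn /del; apply: ler_wiXn2l; rewrite ?invr_ge0 //.
    by rewrite invf_le1 // ler1n.
  by rewrite /d addnS ltnS leq_addr.
have fb u u' : A u -> A u' -> tube B v u = tube B v u' ->
    parity B j u = parity B j u' -> cube B j u != cube B j u' ->
    del <= `|u 0 ord0 - u' 0 ord0|.
  move=> /AB uB /AB uB' T P c; have [l hl] := parity_separated uB uB' P c.
  have := tube_dist l N0 uB uB' T; move: hl Nd; rewrite -/N.
  by have -> : 2^-1 ^+ j = del + del :> R; [rewrite /del exprS; lra|lra].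
apply/negPn/negP; rewrite !negb_or => /and3P[c1 c2 c3].
have Kp : K (x, (y, z)).
  split => //; split; [exact: fb|split; [exact: fb|]] => //.
  by apply: fb; rewrite // -?Txy -?Pxy.
have := epsK _ Kp; rewrite leNgt => /negP; apply.
have mb l : minor l (x, (y, z)) * minor l (x, (y, z)) <= 16 * B%:R ^+ 2 / N%:R.
  have := eq_tube (AB _ Ax) (AB _ Ay) Txy l; have := eq_tube (AB _ Ax) (AB _ Az) Txz l.
  rewrite -/N.
  have bnd u : A u -> `|x 0 ord0 - u 0 ord0| <= 2 * B%:R.
    move=> Au; have := AB _ Ax ord0; have := AB _ Au ord0 => h1 h2.
    by apply: le_trans (ler_normB _ _) _; lra.
  have := bnd _ Ay; have := bnd _ Az.
  set b := x 0 ord0 - y 0 ord0; set b' := x 0 ord0 - z 0 ord0.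
  set e1 := _ - _ * b'; set e2 := _ - _ * b => hb' hb he1 he2.
  (* The minor is a combination of the tube errors [e1] and [e2], both below 1, with coefficients at
     most [2 B]; so it is at most [4 B / N]. *)
  have mE : minor l (x, (y, z)) = (e2 * b' - e1 * b) / N%:R.
    by rewrite /minor /cx /cy /cz /= /e1 /e2 /b /b'; field; rewrite gt_eqF.
  have B0 : 0 <= B%:R :> R by [].
  have mle : `|minor l (x, (y, z))| <= 4 * B%:R / N%:R.
    rewrite mE normrM normfV (gtr0_norm NR) ler_pM2r ?invr_gt0 //.
    apply: le_trans (ler_normB _ _) _; rewrite !normrM.
    have := ler_pM (normr_ge0 e2) (normr_ge0 b') (ltW he2) hb'.
    have := ler_pM (normr_ge0 e1) (normr_ge0 b) (ltW he1) hb.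
    by lra.
  rewrite -expr2 -real_normK ?num_real //.
  apply: le_trans (_ : (4 * B%:R / N%:R) ^+ 2 <= _).
    by rewrite lerXn2r ?nnegrE // divr_ge0 // mulr_ge0.
  rewrite expr_div_n exprMn expr2 -natrM ler_wpM2l ?mulr_ge0 ?exprn_ge0 //.
  by rewrite lef_pV2 ?posrE ?exprn_gt0 // expr2 ler_peMl // ler1n.
apply: le_lt_trans (_ : \sum_(l < m) (16 * B%:R ^+ 2 / N%:R) < _).
  exact: ler_sum.
rewrite sumr_const card_ord -[ltLHS]mulr_natl mulrA ltr_pdivrMr //.
rewrite [ltRHS]mulrC -ltr_pdivrMr // mulrA [m%:R * 16]mulrC.
apply: lt_trans (truncnS_gt _) _; rewrite ltr_nat /N.
apply: leq_ltn_trans (ltn_expl _ (ltnSn 1)).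
by rewrite /d addnS ltnW // ltnS leq_addl.
Qed.

Lemma powR_half_exp (s : R) i : (2^-1 ^+ i) `^ s = (2^-1 `^ s) ^+ i.
Proof.
by rewrite -!powR_mulrn ?powR_ge0 ?invr_ge0 // powRAC.
Qed.

(** Frostman weights with capacities [q^(j+t)], the s-th powers of the side lengths, live on sample
    points of [A], one for each index of a cube of scale 2^-k. The chosen cells cover [A], and their
    cost is at most the total weight up to the factor from the diagonal of a cube. *)
Lemma premeasure_le A B (s : R) j delta : compact A -> (0 < B)%N ->
  (forall x, A x -> inbox B x) ->
  (forall x y z, A x -> A y -> A z -> ~ transversal_line x y z) -> A !=set0 ->
  0 <= s -> 2 ^+ m * 2^-1 `^ s < 1 -> Num.sqrt m.+1%:R * 2^-1 ^+ j <= delta ->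
  (hausdorff_premeasure s delta A <=
   (Num.sqrt m.+1%:R `^ s * (2 * (5 * B%:R) ^+ m * 2 ^+ m.+1 *
     (8 ^+ m * 3 ^+ m.+1 * ((2 ^+ m * 2^-1 `^ s) ^+ j / (1 - 2 ^+ m * 2^-1 `^ s)))))%:E)%E.
Proof.
move=> cA B0 AB noline [x0 Ax0] s0 th1 jdel.
have [d thin] := thin_tubes j cA AB noline.
set q := 2^-1 `^ s in th1 *; have q0 : 0 <= q by exact: powR_ge0.
pose k := (j + d)%N; pose I := {ffun 'I_m.+1 -> 'I_(2 ^ k * (2 * B)).+1}.
(* Indices of cubes that miss [A] get the default [x0]. The repetition is harmless, since weights
   are attached to indices. *)
have /boolp.choice[pt ptP] : forall c : I, exists x, A x /\
    forall y, A y -> (forall l, cube B k y l = c l) -> cube B k x = cube B k y.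
  move=> c; have [[y [Ay yc]]|none] :=
      pselect (exists y, A y /\ forall l, cube B k y l = c l).
    by exists y; split => // z Az zc; apply/ffunP => l; rewrite yc zc.
  by exists x0; split => // y Ay yc; case: none; exists y.
have ptB c : inbox B (pt c) by apply: AB; exact: (ptP c).1.
have rep y : A y -> exists c, cube B k (pt c) = cube B k y.
  move=> Ay; exists [ffun l => inord (cube B k y l)]; apply: (ptP _).2 => // l.
  rewrite [in RHS]ffunE inordK // ltnS ffunE truncn_le_nat -[ltRHS]natr1 !natrM natrX.
  have := AB _ Ay l; rewrite ler_norml => /andP[_ yB].
  have e0 : 0 <= (2 : R) ^+ k by rewrite exprn_ge0.
  have : 2 ^+ k * (y 0 l + B%:R) <= 2 ^+ k * (2 * B%:R).
    by rewrite ler_wpM2l //; lra.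
  by lra.
have [||w [S [tau [w0 mass capS cov]]]] := @frostman_weights R I _ d
  (fun t a => cube B (j + t) (pt a)) (fun t => q ^+ (j + t)).
- by move=> t; rewrite exprn_ge0.
- by move=> t t' x y tt'; apply: cube_nested; rewrite ?leq_add2l.
have W := weight_le ptB w0 q0 B0 mass
  (fun v a b c => @thin v _ _ _ (ptP a).1 (ptP b).1 (ptP c).1) th1.
pose V a : set 'rV[R]_m.+1 :=
  [set y | A y /\ cube B (j + tau a) y = cube B (j + tau a) (pt a)].
have r0 i : 0 <= Num.sqrt m.+1%:R * 2^-1 ^+ i :> R.
  by rewrite mulr_ge0 ?sqrtr_ge0 ?exprn_ge0.
have Vd a : (diam (V a) <= (Num.sqrt m.+1%:R * 2^-1 ^+ (j + tau a))%:E)%E.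
  apply: diam_le => // x y [/AB xB cx] [/AB yB cy].
  apply: enorm_le_coords => [|l]; first by rewrite exprn_ge0.
  by have := eq_cube_near xB yB (etrans cx (esym cy)) l; rewrite !mxE.
apply: le_trans (hausdorff_premeasure_finite_cover (S := S) (V := V)
  (c := fun a => Num.sqrt m.+1%:R `^ s * q ^+ (j + tau a)) _ _ _ _) _.
- by apply: le_trans jdel.
- move=> y Ay; have [c cE] := rep y Ay; have [b bS cb] := cov c.
  exists b => //; split => //; rewrite -cb; apply: (@cube_nested _ _ _ _ k) => //.
    exact: AB.
  by rewrite leq_add2l -ltnS ltn_ord.
- move=> a _; apply: le_trans (Vd a) _; rewrite lee_fin; apply: le_trans jdel.
  by rewrite ler_wpM2l ?sqrtr_ge0 // ler_wiXn2l ?leq_addr //; lra.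
- move=> a _; apply: le_trans (diam_pow_le s0 (r0 _) (Vd a)) _.
  by rewrite lee_fin powRM ?sqrtr_ge0 ?exprn_ge0 // powR_half_exp.
by rewrite lee_fin -mulr_sumr ler_wpM2l ?powR_ge0 // (le_trans capS).
Qed.

(** For [s > m] the ratio [2^m 2^-s] is below 1, so the bound of [premeasure_le] tends to 0 as [j]
    grows, for each fixed [delta]. *)
Lemma hausdorff_measure_no_line A (s : R) : compact A ->
  (forall x y z, A x -> A y -> A z -> ~ transversal_line x y z) ->
  m%:R < s -> hausdorff_measure s A = 0%E.
Proof.
move=> cA noline ms.
have s0 : 0 <= s by apply: le_trans (ltW ms).
suff pre0 delta : 0 < delta -> hausdorff_premeasure s delta A = 0%E.
  apply/eqP; rewrite eq_le; apply/andP; split.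
    by apply: ge_ereal_sup => _ [delta /= d0 <-]; rewrite pre0.
  apply: le_trans (hausdorff_premeasure_ge0 s 1 A) _.
  by apply: ereal_sup_ubound; exists 1 => //=; exact: ltr01.
move=> d0; apply/eqP; rewrite eq_le hausdorff_premeasure_ge0 andbT.
have [Ane|Ae] := pselect (A !=set0); last first.
  apply: le_trans (hausdorff_premeasure_finite_cover (I := 'I_0)
    (S := finset.set0) (V := fun=> set0) (c := fun=> 0) (ltW d0) _ _ _) _.
  - by move=> x Ax; case: Ae; exists x.
  - by move=> t; rewrite inE.
  - by move=> t; rewrite inE.
  by rewrite big1.
have [B B0 AB] := compact_inbox cA.
set q := (2^-1 : R) `^ s.
have th1 : 2 ^+ m * q < 1.
  have h : q < 2^-1 ^+ m.
    rewrite /q -powR_mulrn ?invr_ge0 //.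
    rewrite -(subrK m%:R s) addrC powRD; last by rewrite invr_eq0 pnatr_eq0 implybT.
    rewrite gtr_pMr ?powR_gt0 ?invr_gt0 //.
    have ln0 : ln (2^-1 : R) < 0 by apply: ln_lt0; lra.
    by rewrite /powR invr_eq0 pnatr_eq0 /= -[ltRHS]expR0 ltr_expR pmulr_rlt0 ?subr_gt0.
  have e0 : 0 < (2 : R) ^+ m by rewrite exprn_gt0.
  by move: h; rewrite -(ltr_pM2l e0) -exprMn divff ?expr1n // pnatr_eq0.
have th0 : 0 <= 2 ^+ m * q by rewrite mulr_ge0 ?exprn_ge0 ?powR_ge0.
apply/lee_addgt0Pr => e e0; rewrite add0e.
pose c := Num.sqrt m.+1%:R `^ s * (2 * (5 * B%:R) ^+ m * 2 ^+ m.+1 *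
  (8 ^+ m * 3 ^+ m.+1 / (1 - 2 ^+ m * q))).
have [j /andP[j1 j2]] : exists j, (c * (2 ^+ m * q) ^+ j < e) &&
    (Num.sqrt m.+1%:R * 2^-1 ^+ j < delta).
  have n1 : \forall j \near \oo, c * (2 ^+ m * q) ^+ j < e.
    have : `|2 ^+ m * q| < 1 by rewrite ger0_norm.
    by move=> /(cvg_geometric c) /cvgr_lt; apply.
  have n2 : \forall j \near \oo, Num.sqrt m.+1%:R * 2^-1 ^+ j < delta.
    have : `|2^-1| < 1 :> R by rewrite ger0_norm ?invr_ge0 //; lra.
    by move=> /(cvg_geometric (Num.sqrt m.+1%:R)) /cvgr_lt; apply.
  have [j [h1 h2]] := @filter_ex _ _ _ _ (filterI n1 n2).
  by exists j; rewrite h1 h2.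
apply: le_trans (premeasure_le cA B0 AB noline Ane s0 th1 (ltW j2)) _.
rewrite lee_fin; apply: le_trans (ltW j1); rewrite le_eqVlt; apply/orP; left.
by apply/eqP; rewrite /c; ring.
Qed.

Lemma hausdorff_dim_no_angle A (alpha : R) : compact A ->
  alpha = 0 \/ alpha = pi -> ~ contains_angle A alpha ->
  (hausdorff_dim A <= m%:R%:E)%E.
Proof.
move=> cA al nA; apply/lee_addgt0Pr => e e0; rewrite -EFinD.
apply: ereal_inf_lbound; exists (m%:R + e) => //; split.
  by rewrite addr_ge0 // ltW.
apply: hausdorff_measure_no_line => //; last by rewrite ltrDl.
move=> x y z Ax Ay Az /(transversal_line_contains_angle Ax Ay Az) [c0 cpi].
by apply: nA; case: al => ->.
Qed.

End NoThreeCollinear.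

(** * The thresholds for the angles 0 and pi, with [m = n - 1] *)

Lemma angle_threshold_degenerate (R : realType) m (alpha : R) : (0 < m)%N ->
  alpha = 0 \/ alpha = pi -> angle_threshold m.+1 alpha = m%:R%:E.
Proof.
move=> m0 al; apply/eqP; rewrite eq_le; apply/andP; split.
  apply: ge_ereal_sup => _ [A [cA <- nA]]; exact: hausdorff_dim_no_angle al nA.
apply: le_trans (paraboloid_dim_ge R m0) _; apply: ereal_sup_ubound.
exists (@paraboloid R m); split => //; first exact: compact_paraboloid.
exact: paraboloid_no_angle.
Qed.

Theorem theorem2p3 (R : realType) (n : nat) (hn : (2 <= n)%N) :
  angle_threshold n (0 : R) = (n%:R - 1)%:E /\
  angle_threshold n (pi : R) = (n%:R - 1)%:E.
Proof.
case: n hn => [//|m] m0; rewrite -[m.+1%:R]natr1 addrK.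
by split; apply: angle_threshold_degenerate => //; [left|right].
Qed.
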